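(* Let $\theta\ge2$ be an integer. For $i=1,2$, let $X_{n,i}^{(\theta)}$ be the number of vertices contained in exactly $i$ hyperedges in a hyperrecursive tree with hyperedge size $\theta$ at age $n$. As $n\to\infty$, $$\frac1n\begin{pmatrix}X_{n,1}^{(\theta)}\\[1mm] X_{n,2}^{(\theta)}\end{pmatrix}\ \xrightarrow{\ \mathcal P\ }\ \begin{pmatrix}\dfrac1\theta\\[3mm] \dfrac{\theta-1}{\theta^2}\end{pmatrix}.$$
   Context: Hyperrecursive tree with hyperedge size $\theta$ (an integer $\theta\ge2$): at time $0$ there are $\theta$ originating vertices, all labeled $0$, which together form the first hyperedge. At each time $n\ge1$ a new vertex labeled $n$ is added; a subset of size $\theta-1$ of the $n-1+\theta$ existing vertices is chosen uniformly at random among all subsets of that size (independently of the past), and the new vertex together with the chosen vertices forms a new hyperedge. The structure at time $n$ (right after insertion of vertex $n$) is said to have age $n$. All vertices, including each originator, are counted in $X_{n,i}^{(\theta)}$; $X_{0,1}^{(\theta)}=\theta$, $X_{0,2}^{(\theta)}=0$. $\xrightarrow{\mathcal P}$ denotes convergence in probability. *)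

(* Defs.v *)
From HB Require Import structures.
From mathcomp Require Import all_boot all_order all_algebra.
From mathcomp Require Import finmap.
From mathcomp Require Import all_classical all_reals all_analysis.

Set Implicit Arguments.
Unset Strict Implicit.
Unset Printing Implicit Defensive.

Import Order.TTheory GRing.Theory Num.Theory.
Import numFieldNormedType.Exports.

Local Open Scope classical_set_scope.
Local Open Scope ring_scope.

(* Vertices are renumbered by natural numbers: the theta originators (all
   labeled 0 in the tree) are 0, ..., theta - 1, and the vertex labeled n >= 1 is
   n - 1 + theta. Hence the vertices present at age n are those of
   'I_(n + theta), and a sequence of choices is a dependent function C where
   C k is the set of vertices chosen at time k.+1. *)

Section tree.
Variables (theta : nat) (c : forall k : nat, {set 'I_(k + theta)}).

(* Hyperedge number k is the one created at time k. *)
Definition hyperedge (k : nat) : {fset nat} :=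
  match k with
  | 0 => [fset v | v in iota 0 theta]%fset
  | k'.+1 => ((k' + theta)%N |` [fset nat_of_ord v | v in c k'])%fset
  end.

(* Hyperedges created at distinct times are distinct (each contains a new
   vertex), so counting creation times counts hyperedges. *)
Definition nb_hyperedges (n v : nat) : nat :=
  #|[pred k : 'I_n.+1 | v \in hyperedge k]|.

Definition nb_vertices (n i : nat) : nat :=
  #|[pred v : 'I_(n + theta) | nb_hyperedges n v == i]|.

End tree.

Section process.
Context d (T : measurableType d) (R : realType) (P : probability T R).
Variable theta : nat.
Variable C : forall k : nat, T -> {set 'I_(k + theta)}.

Definition past (n : nat) : set (set T) :=
  <<s [set E | exists k : nat, exists A : {set 'I_(k + theta)},
         (k < n)%N /\ E = C k @^-1` [set A]] >>.

Record hyperrecursive_choices : Prop := HyperrecursiveChoices {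
  choice_measurable : forall (k : nat) (A : {set 'I_(k + theta)}),
    measurable (C k @^-1` [set A]) ;
  choice_uniform : forall (k : nat) (A : {set 'I_(k + theta)}),
    P (C k @^-1` [set A]) =
      (if #|A| == (theta - 1)%N then ('C(k + theta, theta - 1)%:R)^-1
       else 0)%:E ;
  choice_indep_past : forall (k : nat) (A : {set 'I_(k + theta)}) (E : set T),
    past k E ->
    P (C k @^-1` [set A] `&` E) = (P (C k @^-1` [set A]) * P E)%E }.

(* X_{n,i}: the number of vertices in exactly i hyperedges at age n. *)
Definition X (n i : nat) (w : T) : nat := nb_vertices (fun k => C k w) n i.

End process.

Definition cvg_in_probability d (T : measurableType d) (R : realType)
    (P : probability T R) (V : normedModType R) (Y : nat -> T -> V) (l : V) :=
  forall e : R, 0 < e ->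
    P [set w | e < `|Y n w - l|] @[n --> \oo] --> 0%E.

(* Main.v *)
Require Import Defs.
From HB Require Import structures.
From mathcomp Require Import all_boot all_order all_algebra.
From mathcomp Require Import finmap.
From mathcomp Require Import all_classical all_reals all_analysis.
From mathcomp Require Import ring lra zify.

Set Implicit Arguments.
Unset Strict Implicit.
Unset Printing Implicit Defensive.

Import Order.TTheory GRing.Theory Num.Theory.
Import numFieldNormedType.Exports.

Local Open Scope classical_set_scope.
Local Open Scope ring_scope.

(* Write t for theta, a = 1/t, b = (t-1)/t^2, and N = n + t for the number of
   vertices at age n. A given vertex is chosen with probability (t-1)/N, so
   D_n = X_{n,1} - a n and F_n = X_{n,2} - b n have increments bounded by t and
   conditional drifts (t-1)/N (1 - D_n) and (t-1)/N (D_n - F_n - a). Both drifts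
   push back towards 0: 2 D (1 - D) and 2 F (D - F - a) are bounded by 1/2 and
   by D^2 + 1. Hence E D_n^2 = O(n), then E F_n^2 = O(n), and Chebyshev's
   inequality concludes. Only finitely many choices matter at age n, so all
   expectations are finite sums over histories of choices. *)

(** * Uniform random subsets of fixed size *)

Section uniform_subset.
Variables (R : realType) (N k : nat).
Hypothesis k_le_N : (k <= N)%N.

Definition unif_subset (A : {set 'I_N}) : R :=
  if #|A| == k then ('C(N, k)%:R)^-1 else 0.

Lemma unif_subset_ge0 A : 0 <= unif_subset A.
Proof. by rewrite /unif_subset; case: ifP; rewrite // invr_ge0 ler0n. Qed.

Lemma sum_unif_subset : \sum_A unif_subset A = 1.
Proof.
rewrite -big_mkcond/= sumr_const.
have -> : #|[pred A : {set 'I_N} | #|A| == k]| = 'C(N, k).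
  by have := card_draws 'I_N k; rewrite cardsE card_ord.
by rewrite -[LHS]mulr_natl mulfV// pnatr_eq0 -lt0n bin_gt0.
Qed.

(** By complement: the [k]-subsets avoiding [v] are those of the other [N - 1] points, so a fraction
    'C(N-1, k) / 'C(N, k) misses [v]. *)
Lemma sum_unif_subset_mem (v : 'I_N) :
  \sum_A unif_subset A * (v \in A)%:R = k%:R / N%:R.
Proof.
have N_gt0 : (0 < N)%N by case: N v => [[]|].
have -> : \sum_A unif_subset A * (v \in A)%:R =
    1 - \sum_(A : {set 'I_N} | (A \subset ~: [set v]) && (#|A| == k))
          ('C(N, k)%:R)^-1.
  rewrite -[X in X - _]sum_unif_subset [X in _ - X]big_mkcond -sumrB.
  apply: eq_bigr => A _.
  rewrite /unif_subset finset.subsetC finset.sub1set finset.in_setC.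
  by case: (v \in A) => /=; case: (#|A| == k); rewrite ?mulr1 ?mulr0 ?subr0 ?subrr.
rewrite sumr_const.
have -> : #|[pred A : {set 'I_N} | (A \subset ~: [set v]) && (#|A| == k)]| =
    'C(N.-1, k).
  have := cards_draws (~: [set v]) k.
  by rewrite cardsE cardsCs finset.setCK cards1 card_ord subn1.
have C_gt0 : (0 < 'C(N, k))%N by rewrite bin_gt0.
have C_neq0 : 'C(N, k)%:R != 0 :> R by rewrite pnatr_eq0 -lt0n.
rewrite -[X in 1 - X]mulr_natl -[X in X - _](mulfV C_neq0) -mulrBl.
rewrite -natrB; last by rewrite leq_bin2l// leq_pred.
(* For positive [k], Pascal's rule makes the difference 'C(N-1, k-1), and N 'C(N-1, k-1) = k 'C(N,
   k). *)
have H : (('C(N, k) - 'C(N.-1, k)) * N = k * 'C(N, k))%N.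
  case: k k_le_N => [|k'] kN; first by rewrite !bin0 subnn.
  by rewrite -mul_bin_diag -[in 'C(N, _)](prednK N_gt0) binS addKn mulnC.
apply/eqP; rewrite eqr_div ?pnatr_eq0 -?lt0n//.
by rewrite -!natrM H.
Qed.

End uniform_subset.

(** * Finite histories of choices and vertex degrees *)

Section history.
Variable theta : nat.

(** Nested pairs form a finite type, so expectations are finite sums, and induction on age peels off
    the last choice. *)
Fixpoint history (n : nat) : finType :=
  if n is n'.+1 then (history n' * {set 'I_(n' + theta)})%type else unit.

(** The vertex is a bare natural number, so that it keeps its name as the tree grows; vertices not
    yet born get degree 0. *)
Fixpoint degree (n : nat) : history n -> nat -> nat :=
  match n with
  | 0 => fun _ v => (v < theta)%N
  | n'.+1 => fun h v =>
      (degree h.1 v + ((v == n' + theta) || (v \in [seq val u | u in h.2])))%N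
  end.

Fixpoint history_of (c : forall k : nat, {set 'I_(k + theta)}) (n : nat) :
    history n :=
  match n with
  | 0 => tt
  | n'.+1 => (history_of c n', c n')
  end.

Lemma nb_hyperedgesE c n v :
  nb_hyperedges c n v = degree (history_of c n) v.
Proof.
rewrite /nb_hyperedges -sum1_card big_mkcond/=.
under eq_bigr do rewrite inE.
elim: n => [|n IHn].
  by rewrite big_ord_recl big_ord0 addn0/= !inE /= mem_iota add0n; case: ltnP.
rewrite big_ord_recr/= IHn; congr addn.
rewrite !inE.
have -> : (v \in [fset nat_of_ord v | v in c n]%fset) =
          (v \in [seq val u | u in c n]).
  by apply/imfsetP/mapP => -[x]; rewrite ?mem_enum => xA ->;
    exists x; rewrite ?mem_enum.
by case: orP.
Qed.

Lemma degree_gt0 n (h : history n) v : (v < n + theta)%N -> (0 < degree h v)%N.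
Proof.
elim: n h => [|n IHn] h /=; first by move=> ->.
rewrite addSn ltnS leq_eqVlt => /orP[/eqP ->|vn].
  by rewrite eqxx/= addn1.
by rewrite addn_gt0 IHn.
Qed.

Lemma degree_new n (h : history n) v : (n + theta <= v)%N -> degree h v = 0.
Proof.
elim: n h => [|n IHn] h /=; first by rewrite ltnNge => ->.
rewrite addSn => vn; rewrite IHn 1?ltnW// gtn_eqF//= add0n.
case: mapP => // -[x _ vx]; have := ltn_ord x; rewrite -vx.
by rewrite ltnNge ltnW.
Qed.

End history.

(** * Second moments of the deviations *)

Section moments.
Variables (R : realType) (theta : nat).
Hypothesis theta_ge2 : (2 <= theta)%N.

Let u n := @unif_subset R (n + theta) (theta - 1).

Fixpoint weight (n : nat) : history theta n -> R :=
  match n with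
  | 0 => fun=> 1
  | n'.+1 => fun h => weight h.1 * u h.2
  end.

Definition mean n (f : history theta n -> R) : R := \sum_h weight h * f h.

Definition nbdeg n (h : history theta n) (i : nat) : R :=
  \sum_(v < n + theta) (degree h v == i)%:R.

Lemma weight_ge0 n (h : history theta n) : 0 <= weight h.
Proof.
elim: n h => [|n IHn] h //=.
by rewrite mulr_ge0// unif_subset_ge0.
Qed.

Lemma le_mean n (f g : history theta n -> R) :
  (forall h, f h <= g h) -> mean f <= mean g.
Proof. by move=> fg; apply: ler_sum => h _; rewrite ler_wpM2l// weight_ge0. Qed.

Lemma meanD n (f g : history theta n -> R) :
  mean (fun h => f h + g h) = mean f + mean g.
Proof. by rewrite -big_split; apply: eq_bigr => h _; rewrite mulrDr. Qed.

Lemma meanZ n a (f : history theta n -> R) :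
  mean (fun h => a * f h) = a * mean f.
Proof. by rewrite /mean mulr_sumr; apply: eq_bigr => h _; rewrite mulrCA. Qed.

Lemma mean0 (f : history theta 0 -> R) : mean f = f tt.
Proof. by rewrite /mean (big_pred1 tt) ?mul1r// => -[]. Qed.

Lemma meanS n (f : history theta n.+1 -> R) :
  mean f = mean (fun h => \sum_A u A * f (h, A)).
Proof.
rewrite /mean; under [RHS]eq_bigr do rewrite mulr_sumr.
rewrite pair_bigA/=; apply: eq_bigr => -[h A] _ /=; by rewrite mulrA.
Qed.

Let k_le n : (theta - 1 <= n + theta)%N. Proof. lia. Qed.

Lemma mean_cst n a : mean (fun _ : history theta n => a) = a.
Proof.
elim: n => [|n IHn]; first by rewrite mean0.
by rewrite meanS -mulr_suml sum_unif_subset// mul1r.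
Qed.

Definition touched n (h : history theta n) (A : {set 'I_(n + theta)}) i : R :=
  \sum_(v < n + theta) (degree h v == i)%:R * (v \in A)%:R.

(** A chosen vertex passes from its degree to the next one; the last term is the new vertex, which
    enters with degree 1. *)
Lemma nbdegS n (h : history theta n) A i :
  nbdeg ((h, A) : history theta n.+1) i.+1 =
  nbdeg h i.+1 - touched h A i.+1 + touched h A i + (i == 0%N)%:R.
Proof.
rewrite /nbdeg big_ord_recr/= eqxx degree_new// add0n eqSS (eq_sym 0%N).
congr (_ + _); rewrite -sumrB -big_split; apply: eq_bigr => v _ /=.
have -> : (nat_of_ord v \in [seq val x | x in A]) = (v \in A).
  exact: (fintype.mem_image val_inj).
rewrite (ltn_eqF (ltn_ord v))/=; case: (v \in A) => /=.
  by rewrite addn1 eqSS !mulr1 subrr add0r.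
by rewrite addn0 !mulr0 subr0 addr0.
Qed.

Lemma touched0 n (h : history theta n) A : touched h A 0 = 0.
Proof. by apply: big1 => v _; rewrite gtn_eqF ?mul0r// degree_gt0. Qed.

Lemma touched_ge0 n (h : history theta n) A i : 0 <= touched h A i.
Proof. by apply: sumr_ge0 => v _; rewrite mulr_ge0. Qed.

Lemma touched_le n (h : history theta n) A i : touched h A i <= #|A|%:R.
Proof.
rewrite -sum1_card natr_sum big_mkcond; apply: ler_sum => v _ /=.
by case: (v \in A); case: eqP; rewrite ?mulr0 ?mulr1 ?ler01.
Qed.

(** Linearity of expectation: each vertex present is chosen with the same probability. *)
Lemma mean_touched n (h : history theta n) i :
  \sum_A u A * touched h A i = (theta - 1)%:R / (n + theta)%:R * nbdeg h i.
Proof.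
rewrite /touched; under eq_bigr do rewrite mulr_sumr.
rewrite exchange_big mulr_sumr; apply: eq_bigr => v _ /=.
rewrite -(sum_unif_subset_mem R (k_le n) v) mulr_suml.
by apply: eq_bigr => A _; rewrite -mulrA; congr (_ * _); exact: mulrC.
Qed.

(** Expanding the square, the cross term is known exactly through the mean [c]; the bound on [f] is
    needed only on sets of size [k], as the others have weight 0. *)
Lemma sum_unif_sqr_le N k (f : {set 'I_N} -> R) x c K : (k <= N)%N ->
  (forall A : {set 'I_N}, #|A| = k -> `|f A| <= K) ->
  \sum_A unif_subset R k A * f A = c ->
  \sum_A unif_subset R k A * (x + f A) ^+ 2 <= x ^+ 2 + 2 * x * c + K ^+ 2.
Proof.
move=> kN fK fc.
have -> : x ^+ 2 + 2 * x * c + K ^+ 2 = \sum_A unif_subset R k A *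
    (x ^+ 2 + 2 * x * f A + K ^+ 2).
  under eq_bigr do rewrite !mulrDr.
  rewrite !big_split/= -!mulr_suml sum_unif_subset// !mul1r -fc mulr_sumr.
  by congr (_ + _ + _); apply: eq_bigr => A _; rewrite mulrCA.
apply: ler_sum => A _; rewrite /unif_subset; case: eqP => [Ak|_]; last by rewrite !mul0r.
rewrite ler_wpM2l// ?invr_ge0// sqrrD -mulrA mulr_natl lerD2l.
by rewrite -real_normK ?num_real// ler_sqr ?nnegrE ?fK//; exact: le_trans (fK _ Ak).
Qed.

Let t : R := theta%:R.
Let m : R := (theta - 1)%:R.
Let mE : m = t - 1. Proof. by rewrite /m natrB// ltnW. Qed.
Let t_ge2 : 2 <= t. Proof. by rewrite /t ler_nat. Qed.

Definition dev1 n (h : history theta n) : R := nbdeg h 1 - n%:R * t^-1.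
Definition dev2 n (h : history theta n) : R :=
  nbdeg h 2 - n%:R * ((t - 1) / t ^+ 2).

Lemma dev1_step n (h : history theta n) :
  \sum_A u A * dev1 ((h, A) : history theta n.+1) ^+ 2 <=
  dev1 h ^+ 2 + (t ^+ 2 + 1).
Proof.
set N : R := (n + theta)%:R.
have NE : N = n%:R + t by rewrite /N natrD.
have n0 : (0 : R) <= n%:R by [].
have t2 := t_ge2; have m1 := mE.
have N0 : 0 < N by lra.
have t0 : t != 0 by lra.
have it : 0 <= t^-1 <= 1 by rewrite invr_ge0 invf_le1; lra.
have mN : 0 <= m / N <= 1 by rewrite divr_ge0 ?ler_pdivrMr; lra.
have -> : \sum_A u A * dev1 ((h, A) : history theta n.+1) ^+ 2 =
    \sum_A u A * (dev1 h + (1 - t^-1 - touched h A 1)) ^+ 2.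
  apply: eq_bigr => A _; congr (_ * _ ^+ 2); rewrite /dev1 nbdegS touched0 -natr1.
  by rewrite /=; ring.
apply: le_trans.
  (* The mean increment is 1 - 1/t - (m/N) (D + n/t). Since 1 - 1/t = m/t and N - n = t, its
     constant part is m/N. The bound [t] holds because at most [m = t - 1] vertices are touched. *)
  apply: (@sum_unif_sqr_le _ _ _ _ (m / N * (1 - dev1 h)) t) => // [A Ak|].
    have := touched_ge0 h A 1; have := touched_le h A 1; rewrite Ak -/m mE => *.
    by rewrite ler_norml; apply/andP; split; lra.
  under eq_bigr do rewrite mulrBr.
  rewrite sumrB -mulr_suml sum_unif_subset// mean_touched -/m -/N /dev1 mE NE.
  by field; rewrite t0 -NE gt_eqF.
set D := dev1 h in mN *.
rewrite -addrA lerD2l addrC lerD2l.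
have -> : 2 * D * (m / N * (1 - D)) = m / N * (2 * D * (1 - D)) by ring.
apply: (@le_trans _ _ (m / N * 1)); last lra.
by rewrite ler_wpM2l; [|lra|nra].
Qed.

Lemma dev2_step n (h : history theta n) :
  \sum_A u A * dev2 ((h, A) : history theta n.+1) ^+ 2 <=
  dev2 h ^+ 2 + (m / (n + theta)%:R * (dev1 h ^+ 2 + 1) + t ^+ 2).
Proof.
set N : R := (n + theta)%:R.
have NE : N = n%:R + t by rewrite /N natrD.
have n0 : (0 : R) <= n%:R by [].
have t2 := t_ge2; have m1 := mE.
have N0 : 0 < N by lra.
have t0 : t != 0 by lra.
have it : 0 <= t^-1 <= 1 by rewrite invr_ge0 invf_le1; lra.
have mN : 0 <= m / N by rewrite divr_ge0; lra.
set b := (t - 1) / t ^+ 2.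
have hb : 0 <= b <= 1.
  rewrite /b divr_ge0 ?sqr_ge0 ?ler_pdivrMr ?exprn_gt0//=; [|lra|lra].
  by rewrite mul1r; nra.
have -> : \sum_A u A * dev2 ((h, A) : history theta n.+1) ^+ 2 =
    \sum_A u A * (dev2 h + (touched h A 1 - touched h A 2 - b)) ^+ 2.
  apply: eq_bigr => A _; congr (_ * _ ^+ 2); rewrite /dev2 nbdegS -natr1.
  by rewrite /= -/b; ring.
apply: le_trans.
  (* The mean increment is (m/N) (D - F + n/t^2) - m/t^2, and n/N - 1 = -t/N gives the term -1/t. *)
  apply: (@sum_unif_sqr_le _ _ _ _ (m / N * (dev1 h - dev2 h - t^-1)) t) => // [A Ak|].
    have := touched_ge0 h A 1; have := touched_le h A 1.
    have := touched_ge0 h A 2; have := touched_le h A 2; rewrite Ak -/m mE => *.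
    by rewrite ler_norml; apply/andP; split; lra.
  under eq_bigr do rewrite !mulrBr.
  rewrite !sumrB -mulr_suml sum_unif_subset// !mean_touched -/m -/N /dev1 /dev2 mE NE /b.
  by field; rewrite t0 -NE gt_eqF.
set D := dev1 h; set F := dev2 h.
rewrite -addrA lerD2l lerD2r.
have -> : 2 * F * (m / N * (D - F - t^-1)) = m / N * (2 * F * (D - F - t^-1)) by ring.
rewrite ler_wpM2l//.
(* [2 F (D - F - a) <= (D - a)^2 / 2 <= D^2 + a^2] with [a = 1/t] *)
have : 0 <= (D - t^-1 - 2 * F) ^+ 2 by exact: sqr_ge0.
have : 0 <= (D + t^-1) ^+ 2 by exact: sqr_ge0.
have : t^-1 ^+ 2 <= 1 by rewrite expr_le1//; lra.
nra.
Qed.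

(** Each step adds at most t^2 + 1; the extra 1 in the last factor absorbs the initial value D_0 =
    t. *)
Lemma mean_dev1_le n :
  mean (fun h : history theta n => dev1 h ^+ 2) <= (t ^+ 2 + 1) * (n%:R + 1).
Proof.
elim: n => [|n IHn].
  rewrite mean0 /dev1 mul0r subr0 /nbdeg /=.
  rewrite (eq_bigr (fun=> 1)) => [|v _]; last by rewrite ltn_ord.
  by rewrite sumr_const card_ord add0n -/t add0r mulr1 lerDl.
rewrite meanS; apply: le_trans (le_mean (@dev1_step n)) _.
by rewrite meanD mean_cst -natr1; lra.
Qed.

Lemma mean_dev2_le n :
  mean (fun h : history theta n => dev2 h ^+ 2) <=
  (t ^+ 2 + m * (t ^+ 2 + 2)) * n%:R.
Proof.
elim: n => [|n IHn].
  rewrite mean0 mulr0 /dev2 mul0r subr0 /nbdeg /= big1 ?expr0n// => v _.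
  by rewrite ltn_ord.
rewrite meanS; apply: le_trans (le_mean (@dev2_step n)) _.
rewrite !meanD meanZ meanD !mean_cst -[n.+1%:R]natr1.
have n0 : (0 : R) <= n%:R by [].
have t2 := t_ge2; have m1 := mE.
have NE : (n + theta)%:R = n%:R + t by rewrite natrD.
(* The linear growth of the first second moment is cancelled by the factor 1/N, so each step adds a
   bounded amount. *)
suff : m / (n + theta)%:R * (mean (fun h : history theta n => dev1 h ^+ 2) + 1) <=
       m * (t ^+ 2 + 2) by lra.
rewrite NE -mulrA ler_wpM2l//.
rewrite mulrC ler_pdivrMr; last by lra.
have := mean_dev1_le n; nra.
Qed.

End moments.

(** * Law of the random history *)

Section law.
Context d (T : measurableType d) (R : realType) (P : probability T R).
Variables (theta : nat) (C : forall k : nat, T -> {set 'I_(k + theta)}).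
Hypothesis C_choices : hyperrecursive_choices P C.

Definition random_history n (w : T) : history theta n :=
  history_of (fun k => C k w) n.

Lemma random_historyS n h A :
  random_history n.+1 @^-1` [set (h, A)] =
  C n @^-1` [set A] `&` random_history n @^-1` [set h].
Proof. by apply/seteqP; split=> w /= [<- <-]. Qed.

(** This lets [choice_indep_past] separate the next choice from the whole history before it. *)
Lemma random_history_past n h : past C n (random_history n @^-1` [set h]).
Proof.
elim: n h => [|n IHn] h.
  rewrite (_ : _ @^-1` _ = setT); last by apply/seteqP; split=> // w _ /=; case: h.
  exact: (@measurableT _ (g_sigma_algebraType _)).
case: h => h A; rewrite random_historyS.
apply: (@measurableI _ (g_sigma_algebraType _)).
  by apply: sub_sigma_algebra; exists n, A; rewrite ltnS leqnn.
apply: sub_sigma_algebra2 (IHn h) => E [k [B [kn ->]]].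
by exists k, B; rewrite ltnS ltnW.
Qed.

Lemma measurable_random_history n h :
  measurable (random_history n @^-1` [set h]).
Proof.
elim: n h => [|n IHn] h.
  by rewrite (_ : _ @^-1` _ = setT)//; apply/seteqP; split=> // w _ /=; case: h.
case: h => h A; rewrite random_historyS; apply: measurableI; last exact: IHn.
exact: (choice_measurable C_choices).
Qed.

Lemma random_history_law n h :
  P (random_history n @^-1` [set h]) = (weight R h)%:E.
Proof.
elim: n h => [|n IHn] h.
  rewrite (_ : _ @^-1` _ = setT) ?probability_setT//.
  by apply/seteqP; split=> // w _ /=; case: h.
case: h => h A; rewrite random_historyS (choice_indep_past C_choices); last first.
  exact: random_history_past.
by rewrite IHn (choice_uniform C_choices) -EFinM mulrC.
Qed.

(** Markov's inequality: the event is a finite disjoint union of fibres of the history, and [f]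
    dominates the indicator of [Q]. *)
Lemma random_history_markov n (Q : pred (history theta n))
    (f : history theta n -> R) :
  (forall h, 0 <= f h) -> (forall h, Q h -> 1 <= f h) ->
  (P [set w | Q (random_history n w)] <= (mean f)%:E)%E.
Proof.
move=> f0 Qf.
have -> : [set w | Q (random_history n w)] =
    \bigcup_(h in [set` enum Q]) random_history n @^-1` [set h].
  apply/seteqP; split=> [w Qw|w [h /= + ->]]; last by rewrite mem_enum.
  by exists (random_history n w) => //=; rewrite mem_enum.
rewrite measure_fin_bigcup//.
- rewrite -fsbig_seq ?enum_uniq// big_enum/=.
  under eq_bigr do rewrite random_history_law.
  rewrite sumEFin lee_fin /mean big_mkcond; apply: ler_sum => h _.
  have w0 := weight_ge0 R h.
  case: ifP => [Qh|_]; last by rewrite mulr_ge0.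
  by rewrite ler_peMr// Qf.
- by move=> h h' _ _ [w [/= -> ->]].
- by move=> h _; exact: measurable_random_history.
Qed.

Lemma X_nbdeg n i w : (X C n i w)%:R = nbdeg R (random_history n w) i.
Proof.
rewrite /X /nb_vertices /nbdeg -sum1_card big_mkcond natr_sum.
by apply: eq_bigr => v _; rewrite inE nb_hyperedgesE; case: eqP.
Qed.

End law.

(** * From second moments to convergence in probability *)

Lemma norm_col2_gt (R : realType) (e : R) (x : 'cV[R]_2) :
  0 < e -> e < `|x| -> e ^+ 2 <= x 0 0 ^+ 2 + x 1 0 ^+ 2.
Proof.
move=> e0; rewrite /Num.Def.normr/= mx_normrE => ex.
suff [i ei] : exists i, e < `|x i 0|.
  have : e ^+ 2 <= x i 0 ^+ 2.
    by rewrite -[leRHS]real_normK ?num_real// ler_sqr ?nnegrE// ltW.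
  have : 0 <= x 0 0 ^+ 2 by exact: sqr_ge0.
  have : 0 <= x 1 0 ^+ 2 by exact: sqr_ge0.
  case: i {ei} => -[|[|//]] i2.
    by rewrite (_ : Ordinal i2 = 0); [lra|exact: val_inj].
  by rewrite (_ : Ordinal i2 = 1); [lra|exact: val_inj].
(* The matrix norm is the largest absolute value of an entry. This maximum starts from 0, whence the
   use of [0 < e]. *)
apply: contrapT => /forallNP le_e; move: ex; apply/negP; rewrite -leNgt.
apply: bigmax_le => [|[i j] _]; first exact: ltW.
by rewrite /= (ord1 j) leNgt; apply/negP.
Qed.

Theorem corollary5p1 (R : realType) (d : measure_display)
    (T : measurableType d) (P : probability T R) (theta : nat)
    (C : forall k : nat, T -> {set 'I_(k + theta)})
    (theta_ge2 : (2 <= theta)%N)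
    (C_choices : hyperrecursive_choices P C) :
  cvg_in_probability P
    (fun (n : nat) (w : T) =>
       n%:R^-1 *: (\col_(i < 2) (X C n i.+1 w)%:R : 'cV[R]_2))
    (\col_(i < 2) (if i == 0 then theta%:R^-1
                   else (theta%:R - 1) / theta%:R ^+ 2)).
Proof.
move=> e e0.
set l : 'cV[R]_2 := \col_(i < 2) _.
set t : R := theta%:R; set m : R := (theta - 1)%:R.
(* Sum of the two moment constants; the factor 2 turns the n + 2 of [mean_dev1_le] at age n + 1 into
   a multiple of n + 1. *)
pose M := (2 * (t ^+ 2 + 1) + (t ^+ 2 + m * (t ^+ 2 + 2))) / e ^+ 2.
(* Working at age n + 1 avoids dividing by 0 and matches [harmonic n], which is 1/(n + 1). *)
rewrite -cvg_shiftS.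
have M_cvg : (M * @harmonic R n)%:E @[n --> \oo] --> 0%E.
  apply: cvg_EFin; first exact: nearW.
  rewrite -[0](mulr0 M); exact: cvgM (cvg_cst M) cvg_harmonic.
apply: squeeze_cvge (cvg_cst 0%E) M_cvg.
apply: nearW => n; rewrite measure_ge0/=.
(* Chebyshev's normalization: the scaled errors are D/(n + 1) and F/(n + 1), so on [Q] the sum D^2 +
   F^2 is at least (e (n + 1))^2. *)
pose c : R := (e * n.+1%:R) ^- 2.
have n0 : 0 < n.+1%:R :> R by [].
have c0 : 0 <= c by rewrite invr_ge0 sqr_ge0.
pose Q (h : history theta n.+1) :=
  e < `|n.+1%:R^-1 *: (\col_(i < 2) nbdeg R h i.+1 : 'cV[R]_2) - l|.
pose f (h : history theta n.+1) := c * (dev1 R h ^+ 2 + dev2 R h ^+ 2).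
have := @random_history_markov _ _ _ P _ C C_choices n.+1 Q f.
have -> : [set w | Q (random_history C n.+1 w)] = [set w |
    e < `|n.+1%:R^-1 *: (\col_(i < 2) (X C n.+1 i.+1 w)%:R : 'cV[R]_2) - l|].
  apply/funext => w; rewrite /= /Q.
  congr (is_true (_ < `|_ *: _ - _|)); apply/matrixP => i j.
  by rewrite !mxE X_nbdeg.
move=> /(_ _ _)/le_trans; apply=> [h|h Qh|].
- by rewrite mulr_ge0// addr_ge0// sqr_ge0.
- have := norm_col2_gt e0 Qh; rewrite !mxE/= => eh.
  rewrite /f /c mulrC ler_pdivlMr ?exprn_gt0 ?mulr_gt0// mul1r exprMn.
  have -> : dev1 R h = n.+1%:R * (n.+1%:R^-1 * nbdeg R h 1 - t^-1).
    by rewrite /dev1 -/t mulrBr mulVKf// gt_eqF.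
  have -> : dev2 R h = n.+1%:R * (n.+1%:R^-1 * nbdeg R h 2 - (t - 1) / t ^+ 2).
    by rewrite /dev2 -/t mulrBr mulVKf// gt_eqF.
  by rewrite !exprMn -mulrDr mulrC ler_wpM2l ?sqr_ge0.
- rewrite lee_fin /f meanZ meanD.
  have H1 := @mean_dev1_le R theta theta_ge2 n.+1.
  have H2 := @mean_dev2_le R theta theta_ge2 n.+1.
  rewrite -/t -/m in H1 H2.
  have -> : M * harmonic n =
    c * ((2 * (t ^+ 2 + 1) + (t ^+ 2 + m * (t ^+ 2 + 2))) * n.+1%:R).
    have cE (A N : R) : 0 < N -> A / e ^+ 2 / N = (e * N) ^- 2 * (A * N).
      by move=> N0; field; rewrite !gt_eqF.
    exact: cE.
  rewrite ler_wpM2l// mulrDl lerD// (le_trans H1)//.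
  rewrite [2 * _]mulrC -mulrA ler_wpM2l ?addr_ge0 ?sqr_ge0//.
  by have : 1 <= n.+1%:R :> R; [rewrite ler1n | lra].
Qed.
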